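(* Let $d\ge2$. For every $\epsilon>0$ there are constants $C_d$ (depending only on $d$ and $\epsilon$) and $C_{d,\epsilon}$ (depending only on $d$ and $\epsilon$) such that for every collection $\mathcal U$ of dyadic rectangles in $\mathbb R^d$ whose shadow $\operatorname{sh}(\mathcal U)$ has finite measure, there are a set $V\supset\operatorname{sh}(\mathcal U)$ with $|V|\le C_d|\operatorname{sh}(\mathcal U)|$, a map $\operatorname{emb}:\mathcal U\to[1,\infty)$, and a map $\imath:\mathcal U\to\{1,2,\ldots,d\}$ such that $$\operatorname{emb}(R)\cdot R\subset V\qquad\text{for all }R\in\mathcal U,$$ and for all subcollections $\mathcal U'\subset\mathcal U$, $$\sum_{j=1}^d\sum_{v=0}^\infty\sum_{I\in\mathcal D}2^{-(d+\epsilon)v}\,|F(I,j,v,\mathcal U')|\le C_{d,\epsilon}\,|\operatorname{sh}(\mathcal U')|,$$ where $$F(I,j,v,\mathcal U')=\bigcup\{R\in\mathcal U':\ 2^v\le\operatorname{emb}(R)<2^{v+1},\ R_{(j)}=I,\ \imath(R)=j\}.$$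
   Context: The dyadic intervals are $\mathcal D=\{[j2^k,(j+1)2^k): j,k\in\mathbb Z\}$. A dyadic rectangle in $\mathbb R^d$ is a product $R=R_{(1)}\times\cdots\times R_{(d)}$ with each $R_{(i)}\in\mathcal D$. The shadow of a collection $\mathcal U$ of dyadic rectangles is $\operatorname{sh}(\mathcal U)=\bigcup_{R\in\mathcal U}R$. $|A|$ denotes Lebesgue measure. For a rectangle $R$ and $\lambda>0$, $\lambda\cdot R$ is the rectangle with the same center as $R$ whose side length in each coordinate is $\lambda$ times that of $R$. *)

(* Defs.v *)
From HB Require Import structures.
From mathcomp Require Import all_boot all_order all_algebra.
From mathcomp Require Import all_classical all_reals all_analysis.
Set Implicit Arguments.
Unset Strict Implicit.
Unset Printing Implicit Defensive.
Import Order.TTheory GRing.Theory Num.Theory.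
Import numFieldNormedType.Exports.
Local Open Scope classical_set_scope.
Local Open Scope ring_scope.

(* R^d, with the Borel sigma-algebra (generated by the coordinates). *)
Notation Rspace R d := (d.-tuple (measurableTypeR R)).

Section lebesgue_nd.
Local Open Scope ereal_scope.
Variable R : realType.

Definition tcons n (p : measurableTypeR R * Rspace R n) : Rspace R n.+1 :=
  [tuple of p.1 :: p.2].

(* d-dimensional Lebesgue measure: the d-fold product of [lebesgue_measure]
   (on Borel sets; see [lebesgue_nd_box]). *)
Fixpoint lebesgue_nd (d : nat) : set (Rspace R d) -> \bar R :=
  match d return set (Rspace R d) -> \bar R with
  | 0 => \d_ ([tuple] : Rspace R 0)
  | n.+1 =>
    pushforward ((@lebesgue_measure R) \x (@lebesgue_nd n)) (@tcons n)
  end.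

Lemma measurable_tcons n : measurable_fun [set: _] (@tcons n).
Proof. exact: (measurable_cons measurable_fst measurable_snd). Qed.

(* The library's sigma-finiteness instance on [m1 \x m2] is not inferable, so
   sigma-finiteness is established directly and repackaged here. *)
Section sigma_finite_pack.
Context dsp (T : measurableType dsp) (m : {measure set T -> \bar R}).
Context (sm : sigma_finite setT m).
Let f : set T -> \bar R := m.
HB.instance Definition _ := Measure.on f.
HB.instance Definition _ := Measure_isSigmaFinite.Build _ T R f sm.

Lemma sigma_finite_measure_pack :
  exists m' : {sigma_finite_measure set T -> \bar R},
    m' = m :> (set T -> \bar R).
Proof. by exists f. Qed.

End sigma_finite_pack.

Lemma lebesgue_nd_packed d :
  exists m : {sigma_finite_measure set (Rspace R d) -> \bar R},
    lebesgue_nd (d := d) = m.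
Proof.
elim: d => [|n [m mE]]; first by exists (\d_ ([tuple] : Rspace R 0)).
pose P : {measure set _ -> \bar R} := (@lebesgue_measure R) \x m.
have mf := @measurable_tcons n.
have [nu nuP] : exists nu : {measure set (Rspace R n.+1) -> \bar R},
    pushforward P (@tcons n) = nu.
  by eexists; exact: (erefl (Measure.sort
    (measure_function_pushforward__canonical__measure_function_Measure P mf))).
have nuE : lebesgue_nd (d := n.+1) = nu by rewrite /= mE.
have snu : sigma_finite setT nu.
  have /sigma_finiteP[F [UF ndF Foo]] := sigma_finiteT (@lebesgue_measure R).
  have /sigma_finiteP[G [UG ndG Goo]] := sigma_finiteT m.
  pose g (x : Rspace R n.+1) := (thead x, [tuple of behead x] : Rspace R n).
  have mg : measurable_fun [set: _] g.
    apply/measurable_fun_pair => /=; first exact: measurable_tnth.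
    exact: measurable_behead.
  have gf (p : measurableTypeR R * Rspace R n) : g (tcons p) = p.
    by case: p => a t; rewrite /g theadE; congr pair; exact/val_inj.
  exists (fun k => g @^-1` (F k `*` G k)).
    rewrite -preimage_bigcup; apply/esym/seteqP; split => // x _ /=.
    have : [set: measurableTypeR R] (g x).1 by [].
    have : [set: Rspace R n] (g x).2 by [].
    rewrite UF UG => -[k _ Gk] [l _ Fl]; exists (maxn l k) => //; split.
    - by move: Fl; apply: (subsetPset _ _ (ndF _ _ (leq_maxl _ _))).
    - by move: Gk; apply: (subsetPset _ _ (ndG _ _ (leq_maxr _ _))).
  move=> k; have [mF Fk] := Foo k; have [mG Gk] := Goo k; split.
    by rewrite -[X in measurable X]setTI; apply: mg => //; exact: measurableX.
  rewrite -nuP /pushforward (_ : _ @^-1` _ = F k `*` G k).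
    by rewrite [ltLHS]product_measure1E// lte_mul_pinfty// ge0_fin_numE.
  by rewrite -comp_preimage (_ : g \o _ = id)//; exact/funext.
have [nus nusE] := sigma_finite_measure_pack snu.
by exists nus; rewrite nuE -nusE.
Qed.

Section instances.
Variable d : nat.
Local Notation mu := (lebesgue_nd (d := d)).

Let mu0 : mu set0 = 0.
Proof. by have [m ->] := lebesgue_nd_packed d; exact: measure0. Qed.

Let mu_ge0 A : 0 <= mu A.
Proof. by have [m ->] := lebesgue_nd_packed d; exact: measure_ge0. Qed.

Let mu_sigma_additive : semi_sigma_additive mu.
Proof.
by have [m ->] := lebesgue_nd_packed d; exact: measure_semi_sigma_additive.
Qed.

HB.instance Definition _ := isMeasure.Build _ _ _ mu
  mu0 mu_ge0 mu_sigma_additive.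

Let mu_sigma_finite : sigma_finite setT mu.
Proof. by have [m ->] := lebesgue_nd_packed d; exact: sigma_finiteT. Qed.

HB.instance Definition _ := Measure_isSigmaFinite.Build _ _ _ mu
  mu_sigma_finite.

End instances.

Lemma lebesgue_nd_box d (A : 'I_d -> set (measurableTypeR R)) :
  (forall i, measurable (A i)) ->
  lebesgue_nd [set x : Rspace R d | forall i, A i (tnth x i)]
  = \prod_(i < d) lebesgue_measure (A i).
Proof.
elim: d A => [|n IH] A mA.
  rewrite big_ord0 /= diracE mem_set//= => i; by case: i.
rewrite big_ord_recl -IH; last by move=> i; exact: mA.
have [m mE] := lebesgue_nd_packed n.
rewrite /= /pushforward mE -(product_measure1E lebesgue_measure m)//.
- congr (_ _); apply/seteqP; split => -[a t] /=.
    move=> H; split; first exact: (H ord0).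
    by move=> i; have := H (lift ord0 i); rewrite tnthS.
  move=> [H0 H] i; case: (unliftP ord0 i) => [j ->|-> //].
  by rewrite tnthS.
- rewrite (_ : [set x | _] = \bigcap_(i in [set: 'I_n])
      ((fun x : Rspace R n => tnth x i) @^-1` A (lift ord0 i))).
    apply: fin_bigcap_measurable => // i _; rewrite -[X in measurable X]setTI.
    exact: measurable_tnth.
  by apply/seteqP; split => x H i; [move=> _|]; exact: H.
Qed.

End lebesgue_nd.

Section dyadic.
Variable R : realType.

Definition dyadic : set (interval R) :=
  [set I | exists j k : int, I = `[j%:~R * 2 ^ k, (j + 1)%:~R * 2 ^ k[].

Variable d : nat.
Implicit Types (Q : d.-tuple (interval R)) (U : set (d.-tuple (interval R))).

(* A rectangle is given by its sides; dyadic intervals being nonempty, a dyadic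
   rectangle is determined by its set of points. *)
Definition rect_set Q : set (Rspace R d) :=
  [set x | forall i : 'I_d, [set` tnth Q i] (tnth x i)].

Definition dyadic_rect : set (d.-tuple (interval R)) :=
  [set Q | forall i : 'I_d, dyadic (tnth Q i)].

Definition shadow U : set (Rspace R d) := \bigcup_(Q in U) rect_set Q.

(* Concentric dilation; only meaningful for bounded intervals. *)
Definition dilate_itv (l : R) (I : interval R) : interval R :=
  match I with
  | Interval (BSide b x) (BSide c y) =>
      let m := (x + y) / 2 in let h := l * (y - x) / 2 in
      Interval (BSide b (m - h)) (BSide c (m + h))
  | _ => I
  end.

Definition dilate (l : R) Q : d.-tuple (interval R) :=
  [tuple of map (dilate_itv l) Q].

Definition Fset (emb : d.-tuple (interval R) -> R)
    (iota : d.-tuple (interval R) -> 'I_d)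
    (I : interval R) (j : 'I_d) (v : nat) U : set (Rspace R d) :=
  shadow [set Q | [/\ U Q, 2 ^+ v <= emb Q < 2 ^+ v.+1,
                      tnth Q j = I & iota Q = j]].

End dyadic.

Arguments dyadic {R}.
Arguments dyadic_rect {R d}.

(* Main.v *)
Require Import Defs.
From HB Require Import structures.
From mathcomp Require Import all_boot all_order all_algebra.
From mathcomp Require Import all_classical all_reals all_analysis.
From mathcomp Require Import measurable_realfun.
From mathcomp Require Import ring lra zify.
Set Implicit Arguments.
Unset Strict Implicit.
Unset Printing Implicit Defensive.
Import Order.TTheory GRing.Theory Num.Theory.
Import numFieldNormedType.Exports.
Local Open Scope classical_set_scope.
Local Open Scope ring_scope.

(** The proof is an iterated stopping-time argument, one coordinate at a time.

    Put V_0 = sh(U) and let V_(j+1) be the union of all dyadic boxes at least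
    half filled by V_j.  Such a union is at most K times as large as V_j, by
    the weak-type bound for the strong dyadic maximal function
    ([strong_density]): only the density 1/2 matters, so it follows from the
    one-dimensional bound [dyadic_density] by induction on the dimension.

    For a rectangle R and a level m let R^(j,m) be R with its first j sides
    replaced by their m-th dyadic ancestors.  Call m good when every R^(j+1,m)
    with j < d is half filled by V_j.  Level 0 is good; large levels are not,
    as |V_d| is finite and R^(d,m) is contained in V_d when m is good.  Let v
    be the last level before the first bad one, emb(R) = 2^v, and iota(R) the
    first coordinate j at which level v+1 fails.  The concentric dilate of a
    side by 2^v lies in the triple of its v-th ancestor, so V is obtained from
    V_d by tripling its constituent boxes, and |V| <= 3^d K^d |sh(U)|.

    For the sum, fix j and v and let H_I be the union of the boxes
    P = R^(j,v+1) over the R in U' with emb(R) = 2^v, iota(R) = j, R_(j) = I.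
    Minimality of j gives P inside V_j, and failure at j says that V_j fills
    less than half of P^+ = R^(j+1,v+1).  Let W_I be the union of the H_J with
    J containing the ancestor I' of order v+1 of I.  Above I' it is invariant
    along the coordinate j, hence it fills the same fraction, less than half,
    of P as of P^+ ([slab_le], [half_outside]).  By the strong density bound
    |H_I| <= K |H_I \ W_I|.  Two sets H_I \ W_I can meet only if the scales of
    their intervals differ by less than v+1, so
      sum_I |H_I \ W_I| <= (v+1) |union of all P|,
    and the union of all P is at most (2^(v+1))^j times |sh(U')|, since
    passing to ancestors of order m in one coordinate multiplies a shadow by
    at most 2^m ([measure_bigcup_anc_lt]).  As j <= d-1 and v+1 <= 2^v, the
    weight 2^(-(d+eps)v) leaves a geometric series of ratio 2^(-eps). *)

(** * Countable unions of measurable sets *)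

Section countable_unions.
Context d (T : measurableType d) (R : realType).
Local Open Scope ereal_scope.

Lemma countType_bigcup_measurable (C : countType) (M : set C) (F : C -> set T) :
  (forall c, measurable (F c)) -> measurable (\bigcup_(c in M) F c).
Proof.
move=> mF; rewrite bigcup_mkcond; apply: countable_bigcupT_measurable => //.
by move=> c; case: ifP.
Qed.

(** A family of sets indexed by an arbitrary type is countable as soon as it
    factors through a countable type; this makes shadows of arbitrary
    collections measurable. *)
Lemma measurable_bigcup_factor (C : countType) S (X : set S) (f : S -> C)
    (F : C -> set T) :
  (forall c, measurable (F c)) -> measurable (\bigcup_(s in X) F (f s)).
Proof.
by move=> mF; rewrite -bigcup_image; exact: countType_bigcup_measurable.
Qed.

Lemma le_mu (mu : {measure set T -> \bar R}) (A B : set T) :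
  measurable A -> measurable B -> A `<=` B -> mu A <= mu B.
Proof. by move=> mA mB; apply: le_measure; rewrite inE. Qed.

(** Subadditivity on the left, additivity on the right: a comparison of
    individual measures passes to unions when the larger sets are disjoint.
    In the applications these are cut out by maximal dyadic intervals. *)
Lemma le_measure_bigcup_disjoint (mu : {measure set T -> \bar R})
    (C : countType) (M : set C) (F G : C -> set T) (k : R) :
  (0 <= k)%R ->
  (forall c, measurable (F c)) -> (forall c, measurable (G c)) ->
  trivIset M G -> (forall c, M c -> mu (F c) <= k%:E * mu (G c)) ->
  mu (\bigcup_(c in M) F c) <= k%:E * mu (\bigcup_(c in M) G c).
Proof.
move=> k0 mF mG tG FG.
pose ext (H : C -> set T) (n : nat) : set T :=
  if pickle_inv n is Some c then (if c \in M then H c else set0) else set0.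
have extE H : \bigcup_(c in M) H c = \bigcup_n ext H n.
  apply/seteqP; split => x.
    move=> [c Mc Hc]; exists (pickle c) => //.
    by rewrite /ext pickleK_inv mem_set.
  move=> [n _]; rewrite /ext; case: pickle_inv => // c.
  by case: ifPn => // /set_mem Mc Hx; exists c.
have mext H : (forall c, measurable (H c)) -> forall n, measurable (ext H n).
  by move=> mH n; rewrite /ext; case: pickle_inv => // c; case: ifP.
have tE : trivIset setT (ext G).
  move=> m n _ _ [x []]; rewrite /ext.
  case: (pickle_inv m) (pickle_invK (T := C) m) => // c /= <-.
  case: (pickle_inv n) (pickle_invK (T := C) n) => // c' /= <-.
  case: ifPn => // /set_mem Mc Gc; case: ifPn => // /set_mem Mc' Gc'.
  by congr pickle; apply: tG => //; exists x.
rewrite !extE; apply: (@le_trans _ _ (\sum_(0 <= n <oo) mu (ext F n))).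
  apply: measure_sigma_subadditive => //; first exact: mext.
  by apply: bigcupT_measurable; exact: mext.
rewrite (measure_bigcup mu) //; last by move=> n _; exact: mext.
rewrite -nneseriesZl //.
rewrite [leRHS](eq_eseriesl (Q := xpredT)); last by move=> n; rewrite in_setT.
apply: lee_nneseries => [n _ _|n _]; first exact: measure_ge0.
rewrite /ext; case: pickle_inv => [c|]; last by rewrite measure0 mule0.
by case: ifPn => [/set_mem /FG //|_]; rewrite measure0 mule0.
Qed.

End countable_unions.

(** * Dyadic intervals on the line *)

Section dyadic_line.
Variable R : realType.
Notation line := (measurableTypeR R).
Implicit Types (p q : int * int) (m : nat).

(** The pair (n, k) codes the interval [n 2^k, (n+1) 2^k); integer codes make
    dyadic ancestors an arithmetic operation and the index type countable. *)
Definition ditv p : interval R :=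
  `[p.1%:~R * 2 ^ p.2, (p.1 + 1)%:~R * 2 ^ p.2[.

Definition dset p : set line := [set` ditv p].

Definition tset p : set line :=
  [set` `[(p.1 - 1)%:~R * 2 ^ p.2, (p.1 + 2)%:~R * 2 ^ p.2[ : interval R].

Definition anc m p : int * int := ((p.1 %/ 2 ^+ m)%Z, p.2 + m%:Z).

Lemma measurable_dset p : measurable (dset p).
Proof. exact: measurable_itv. Qed.

Lemma measurable_tset p : measurable (tset p).
Proof. exact: measurable_itv. Qed.

Lemma pow2_gt0 (k : int) : 0 < 2 ^ k :> R.
Proof. by rewrite exprz_gt0. Qed.

Lemma measure_dset p : lebesgue_measure (dset p) = (2 ^ p.2)%:E.
Proof.
have h := pow2_gt0 p.2.
rewrite lebesgue_measure_itv /= lte_fin ltr_pM2r// ltr_int.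
rewrite ifT; last by rewrite ltrDl.
rewrite -EFinB; congr EFin; rewrite intrD; ring.
Qed.

Lemma measure_tset p : lebesgue_measure (tset p) = (3 * 2 ^ p.2)%:E.
Proof.
have h := pow2_gt0 p.2.
rewrite lebesgue_measure_itv /= lte_fin ltr_pM2r// ltr_int.
rewrite ifT; last by lia.
rewrite -EFinB; congr EFin; rewrite intrB intrD; ring.
Qed.

(** At each scale the code of the dyadic interval through a point is an integer
    part, hence unique; nestedness and the semigroup law of ancestors below
    reduce to this. *)
Lemma dsetP p x : dset p x <-> Num.floor (x / 2 ^ p.2) = p.1.
Proof.
have h := pow2_gt0 p.2.
rewrite /dset /ditv /= in_itv /= -ler_pdivlMr// -ltr_pdivrMr//.
by split => [/floor_def//|<-]; exact: floor_itv.
Qed.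

Lemma dset_sub_tset p : dset p `<=` tset p.
Proof.
move=> x; rewrite /dset /ditv /tset /= !in_itv /= => /andP[h1 h2].
apply/andP; split.
  by apply: le_trans h1; rewrite ler_pM2r ?pow2_gt0// ler_int; lia.
by apply: lt_trans h2 _; rewrite ltr_pM2r ?pow2_gt0// ltr_int; lia.
Qed.

Lemma tset_mono p q : dset p `<=` dset q -> tset p `<=` tset q.
Proof.
rewrite /dset /ditv /tset; move: (p.1) (q.1) (2 ^ p.2) (2 ^ q.2) (pow2_gt0 p.2).
move=> m n s t s0 pq.
have /andP[nm mn] : n%:~R * t <= m%:~R * s < (n + 1)%:~R * t.
  have := pq (m%:~R * s); rewrite /= !in_itv /=; apply.
  by rewrite lexx ltr_pM2r// ltr_int; lia.
have {mn} : (m + 1)%:~R * s <= (n + 1)%:~R * t.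
  rewrite leNgt; apply/negP => h; have := pq ((n + 1)%:~R * t).
  by rewrite /= !in_itv /= h (ltW mn) ltxx andbF => /(_ isT).
move=> mn x /=; rewrite !in_itv /=.
rewrite !(intrD, intrB) in nm mn * => /andP[h1 h2]; apply/andP; split; nra.
Qed.

Lemma anc0 p : anc 0 p = p.
Proof. by case: p => n k; rewrite /anc expr0 divz1 addr0. Qed.

Lemma dset_anc m p : dset p `<=` dset (anc m p).
Proof.
move=> x; rewrite /dset /ditv /= !in_itv /= expfzDr ?pnatr_eq0// -exprnP.
set t := 2 ^ p.2; have t0 : 0 < t by exact: pow2_gt0.
have E : (2 ^+ m : R) = (2 ^+ m : int)%:~R by rewrite rmorphXn.
rewrite E [t * _]mulrC !mulrA -!intrM => /andP[h1 h2]; apply/andP; split.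
  apply: le_trans h1; rewrite ler_pM2r// ler_int.
  by rewrite lez_floor// expf_neq0.
apply: lt_le_trans h2 _; rewrite ler_pM2r// ler_int.
by have := @ltz_ceil p.1 (2 ^+ m); rewrite exprn_gt0// => /(_ isT); lia.
Qed.

Lemma dset_nested p q x : dset p x -> dset q x -> p.2 <= q.2 ->
  q = anc `|q.2 - p.2| p.
Proof.
move=> px qx pq; have /dsetP := dset_anc `|q.2 - p.2| px.
have E : (anc `|q.2 - p.2| p).2 = q.2 by rewrite /anc /=; lia.
rewrite E => h1; move/dsetP : qx; rewrite h1 => h2.
exact: injective_projections.
Qed.

Lemma anc_anc m n p x : dset p x -> anc m (anc n p) = anc (n + m) p.
Proof.
move=> px; have /dsetP h1 := dset_anc m (dset_anc n px).
have /dsetP h2 := dset_anc (n + m) px.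
apply: injective_projections; last by rewrite /anc /=; lia.
rewrite -h1 -h2; congr (Num.floor (_ / 2 ^ _)).
by rewrite /anc /=; lia.
Qed.

(** With lengths bounded above, every chain of ancestors inside the family
    stops, so each interval lies in a maximal one; maximal ones are disjoint by
    nestedness. *)
Lemma dset_maximal S (X : set S) (f : S -> int * int) (B : R) :
  (forall s, X s -> 2 ^ (f s).2 <= B) ->
  exists M : set (int * int), [/\ M `<=` f @` X, trivIset M dset &
    forall s, X s -> exists2 p, M p & dset (f s) `<=` dset p].
Proof.
move=> fB.
pose M := [set p | (f @` X) p /\ forall m, (f @` X) (anc m p) -> m = 0%N].
exists M; split; first by move=> p [].
  move=> p q [[s Xs sp] Mp] [[t Xt tq] Mq] [x [px qx]].
  wlog pq : p q s t Xs Xt sp tq Mp Mq px qx / p.2 <= q.2.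
    move=> H; case: (leP p.2 q.2) => [|/ltW] h; first exact: (H p q s t).
    by apply/esym/(H q p t s).
  have E := dset_nested px qx pq.
  have h : `|q.2 - p.2|%N = 0%N by apply: Mp; rewrite -E; exists t.
  by rewrite E h anc0.
move=> s Xs.
have [x sx] : exists x, dset (f s) x.
  exists ((f s).1%:~R * 2 ^ (f s).2); apply/dsetP.
  by rewrite mulfK ?intrKfloor// gt_eqF ?pow2_gt0.
pose P m := `[< (f @` X) (anc m (f s)) >].
have exP : exists m, P m by exists 0%N; apply/asboolP; rewrite anc0; exists s.
have bP m : P m -> (m <= Num.trunc (B / 2 ^ (f s).2))%N.
  move=> /asboolP[t Xt tE]; have := fB _ Xt; rewrite tE /anc /=.
  rewrite expfzDr ?pnatr_eq0// -exprnP => h.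
  have B0 : 0 <= B by apply: le_trans h; rewrite mulr_ge0// ltW// pow2_gt0.
  rewrite truncn_ge_nat; last by rewrite divr_ge0// (ltW (pow2_gt0 _)).
  rewrite ler_pdivlMr ?pow2_gt0//; apply: le_trans h.
  rewrite mulrC ler_pM2l ?pow2_gt0// -natrX ler_nat.
  exact/ltnW/ltn_expl.
case: (ex_maxnP exP bP) => m /asboolP Pm maxm.
exists (anc m (f s)); last exact: dset_anc.
split => // k; rewrite (anc_anc k m sx) => h.
have : P (m + k)%N by apply/asboolP.
by move=> /maxm; lia.
Qed.

Local Open Scope ereal_scope.

(** The weak-type (1,1) bound for the dyadic maximal function on the line: sum
    over the maximal intervals, which are disjoint. *)
Lemma dyadic_density S (X : set S) (f : S -> int * int) (G : set line) (c : R) :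
  (0 < c)%R -> measurable G ->
  (forall s, X s -> lebesgue_measure (dset (f s)) <=
                    c%:E * lebesgue_measure (dset (f s) `&` G)) ->
  lebesgue_measure (\bigcup_(s in X) dset (f s)) <= c%:E * lebesgue_measure G.
Proof.
move=> c0 mG fG.
have [->|Gfin] := eqVneq (lebesgue_measure G) +oo.
  by rewrite gt0_muley ?lte_fin// leey.
have {}Gfin : lebesgue_measure G = (fine (lebesgue_measure G))%:E.
  by rewrite fineK// ge0_fin_numE// ltey.
have [s Xs|M [MX tM Mmax]] :=
    @dset_maximal _ X f (c * fine (lebesgue_measure G)).
  rewrite -lee_fin EFinM -Gfin -measure_dset; apply: le_trans (fG s Xs) _.
  rewrite lee_pmul2l ?lte_fin//; apply: le_mu => //.
  by apply: measurableI => //; exact: measurable_dset.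
have md := measurable_dset.
have mdG p : measurable (dset p `&` G) by exact: measurableI.
apply: (@le_trans _ _ (lebesgue_measure (\bigcup_(p in M) dset p))).
  apply: le_mu; [exact: measurable_bigcup_factor|
                 exact: countType_bigcup_measurable|].
  by move=> x [s Xs sx]; have [p Mp sp] := Mmax s Xs; exists p => //; exact: sp.
apply: (@le_trans _ _
    (c%:E * lebesgue_measure (\bigcup_(p in M) (dset p `&` G)))).
  apply: le_measure_bigcup_disjoint => //; first exact: ltW.
    move=> p q Mp Mq [x [[px _] [qx _]]].
    by apply: tM => //; exists x.
  by move=> p /MX[s Xs <-]; exact: fG.
rewrite lee_pmul2l ?lte_fin//; apply: le_mu => //.
  exact: countType_bigcup_measurable.
by move=> x [p _ []].
Qed.

(** Each m-th ancestor is filled to the fraction 2^-m by the original union. *)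
Lemma measure_bigcup_anc S (X : set S) (f : S -> int * int) m :
  lebesgue_measure (\bigcup_(s in X) dset (anc m (f s))) <=
  (2 ^+ m)%:E * lebesgue_measure (\bigcup_(s in X) dset (f s)).
Proof.
have md := measurable_dset.
apply: (@dyadic_density _ X (fun s => anc m (f s))).
- exact: exprn_gt0.
- exact: measurable_bigcup_factor.
move=> s Xs; rewrite measure_dset /anc /= expfzDr ?pnatr_eq0// -exprnP mulrC.
rewrite EFinM -measure_dset lee_pmul2l ?lte_fin ?exprn_gt0//.
apply: le_mu => //.
  by apply: measurableI => //; exact: measurable_bigcup_factor.
by move=> x sx; split; [exact: dset_anc|exists s].
Qed.

Lemma measure_bigcup_tset S (X : set S) (f : S -> int * int) :
  lebesgue_measure (\bigcup_(s in X) tset (f s)) <=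
  3%:E * lebesgue_measure (\bigcup_(s in X) dset (f s)).
Proof.
have md := measurable_dset; have mt := measurable_tset.
set L := lebesgue_measure (\bigcup_(s in X) dset (f s)).
have [->|Lfin] := eqVneq L +oo; first by rewrite gt0_muley ?lte_fin// leey.
have {}Lfin : L = (fine L)%:E.
  by rewrite fineK// ge0_fin_numE ?ltey//; exact: measure_ge0.
have [s Xs|M [MX tM Mmax]] := @dset_maximal _ X f (fine L).
  rewrite -lee_fin -Lfin -measure_dset; apply: le_mu => //.
    exact: measurable_bigcup_factor.
  by move=> x sx; exists s.
apply: (@le_trans _ _ (lebesgue_measure (\bigcup_(p in M) tset p))).
  apply: le_mu; [exact: measurable_bigcup_factor|
                 exact: countType_bigcup_measurable|].
  move=> x [s Xs sx]; have [p Mp sp] := Mmax s Xs; exists p => //.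
  exact: tset_mono sx.
apply: (@le_trans _ _ (3%:E * lebesgue_measure (\bigcup_(p in M) dset p))).
  apply: le_measure_bigcup_disjoint => // p Mp.
  by rewrite [leLHS]measure_tset [X in _ * X]measure_dset EFinM.
rewrite lee_pmul2l ?lte_fin//; apply: le_mu => //.
- exact: countType_bigcup_measurable.
- exact: measurable_bigcup_factor.
by move=> x [p /MX[s Xs <-]]; exists s.
Qed.

End dyadic_line.
(** * Sections of the product measure along one coordinate *)

Section sections.
Variable R : realType.
Local Open Scope ereal_scope.
Notation line := (measurableTypeR R).

Lemma measurable_tcons_preimage n (A : set (Rspace R n.+1)) :
  measurable A -> measurable (@tcons R n @^-1` A).
Proof.
move=> mA; rewrite -[X in measurable X]setTI.
exact: (@measurable_tcons R n).
Qed.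

Lemma measurable_section n (G : set (Rspace R n.+1)) a :
  measurable G -> measurable [set y | G (tcons (a, y))].
Proof.
move=> mG; rewrite (_ : [set y | _] = xsection (@tcons R n @^-1` G) a).
  by apply: measurable_xsection; exact: measurable_tcons_preimage.
by apply/seteqP; split => y; rewrite /xsection /= inE.
Qed.

Lemma nd_xsection_le n (A B : set (Rspace R n.+1)) (c : R) : (0 <= c)%R ->
  measurable A -> measurable B ->
  (forall a, lebesgue_nd [set y | A (tcons (a, y))] <=
             c%:E * lebesgue_nd [set y | B (tcons (a, y))]) ->
  lebesgue_nd A <= c%:E * lebesgue_nd B.
Proof.
move=> c0 /measurable_tcons_preimage mA /measurable_tcons_preimage mB AB.
pose m2 : {sigma_finite_measure set _ -> \bar R} := @lebesgue_nd R n.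
have secE (C : set (Rspace R n.+1)) a :
    [set y | C (tcons (a, y))] = xsection (@tcons R n @^-1` C) a.
  by apply/seteqP; split => y; rewrite /xsection /= inE.
have nn (X : set (line * Rspace R n)) (a : line) :
  [set: line] a -> 0 <= m2 (xsection X a) by move=> _; exact: measure_ge0.
rewrite /= /pushforward.
pose sec C a := (m2 \o xsection (@tcons R n @^-1` C)) a.
rewrite -[leLHS]/(\int[lebesgue_measure]_a sec A a).
rewrite -[X in _ * X]/(\int[lebesgue_measure]_a sec B a).
rewrite -ge0_integralZl_EFin//; last exact: measurable_fun_xsection.
apply: ge0_le_integral => //; first exact: measurable_fun_xsection.
  by apply: measurable_funeM; exact: measurable_fun_xsection.
by move=> a _; have := AB a; rewrite !secE.
Qed.

Lemma nd_ysection_le n (A B : set (Rspace R n.+1)) (c : R) : (0 <= c)%R ->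
  measurable A -> measurable B ->
  (forall y, lebesgue_measure [set a | A (tcons (a, y))] <=
             c%:E * lebesgue_measure [set a | B (tcons (a, y))]) ->
  lebesgue_nd A <= c%:E * lebesgue_nd B.
Proof.
move=> c0 /measurable_tcons_preimage mA /measurable_tcons_preimage mB AB.
pose m1 : {sigma_finite_measure set _ -> \bar R} := @lebesgue_measure R.
pose m2 : {sigma_finite_measure set _ -> \bar R} := @lebesgue_nd R n.
have secE (C : set (Rspace R n.+1)) y :
    [set a | C (tcons (a, y))] = ysection (@tcons R n @^-1` C) y.
  by apply/seteqP; split => a; rewrite /ysection /= inE.
have prodE (C : set (Rspace R n.+1)) : measurable (@tcons R n @^-1` C) ->
    lebesgue_nd C = \int[m2]_y (m1 \o ysection (@tcons R n @^-1` C)) y.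
  move=> mC; rewrite -[RHS]/((m1 \x^ m2) (@tcons R n @^-1` C)).
  rewrite -[LHS]/((m1 \x m2) (@tcons R n @^-1` C)).
  apply: product_measure_unique => // X Y mX mY.
  exact: product_measure2E.
rewrite !prodE// -ge0_integralZl_EFin//; last first.
  exact: measurable_fun_ysection.
apply: ge0_le_integral => //; first exact: measurable_fun_ysection.
  by apply: measurable_funeM; exact: measurable_fun_ysection.
by move=> y _; have := AB y; rewrite !secE.
Qed.

(** [upd k x] parametrises the line through x in the direction k. *)
Definition upd d (k : 'I_d) (x : Rspace R d) (t : line) : Rspace R d :=
  [tuple if i == k then t else tnth x i | i < d].

Lemma measurable_upd d (k : 'I_d) x : measurable_fun [set: line] (upd k x).
Proof.
apply/measurable_fun_tnthP => i /=.
rewrite (_ : _ \o _ = fun t => if i == k then t else tnth x i).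
  by case: eqP.
by apply/funext => t /=; rewrite tnth_mktuple.
Qed.

Lemma measurable_slice d (k : 'I_d) x (A : set (Rspace R d)) :
  measurable A -> measurable (upd k x @^-1` A).
Proof.
move=> mA; rewrite -[X in measurable X]setTI.
exact: (measurable_upd k x).
Qed.

Lemma upd_tcons0 n (a t : line) (y : Rspace R n) :
  upd ord0 (tcons (a, y)) t = tcons (t, y).
Proof.
apply: eq_from_tnth => i; rewrite tnth_mktuple.
by case: (unliftP ord0 i) => [j|] ->; rewrite ?eqxx// ?tnthS.
Qed.

Lemma upd_tconsS n (k : 'I_n) (a t : line) (y : Rspace R n) :
  upd (lift ord0 k) (tcons (a, y)) t = tcons (a, upd k y t).
Proof.
apply: eq_from_tnth => i; rewrite tnth_mktuple.
case: (unliftP ord0 i) => [j|] ->; last by [].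
by rewrite (inj_eq lift_inj) !tnthS tnth_mktuple.
Qed.

(** Fubini in an arbitrary coordinate, in the form of a comparison.  The
    measure is built by adding coordinates in front, so the induction peels
    off the first coordinate until the chosen one is in front. *)
Lemma nd_slice_le d (k : 'I_d) (A B : set (Rspace R d)) (c : R) : (0 <= c)%R ->
  measurable A -> measurable B ->
  (forall x, lebesgue_measure (upd k x @^-1` A) <=
             c%:E * lebesgue_measure (upd k x @^-1` B)) ->
  lebesgue_nd A <= c%:E * lebesgue_nd B.
Proof.
move=> c0; elim: d k A B => [[]//|n IH] k A B mA mB AB.
case: (unliftP ord0 k) => [k'|] kE; last first.
  apply: nd_ysection_le => // y; have := AB (tcons (0%R, y)).
  rewrite kE; set C := _ @^-1` A; set D := _ @^-1` B.
  have -> : C = [set a | A (tcons (a, y))].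
    by apply/funext => a; rewrite /C /= upd_tcons0.
  have -> // : D = [set a | B (tcons (a, y))].
  by apply/funext => a; rewrite /D /= upd_tcons0.
apply: nd_xsection_le => // a.
apply: (IH k') => [| |y]; do ?exact: measurable_section.
have := AB (tcons (a, y)); rewrite kE.
set C := _ @^-1` A; set D := _ @^-1` B.
have -> : C = upd k' y @^-1` [set y | A (tcons (a, y))].
  by apply/funext => t; rewrite /C /= upd_tconsS.
have -> // : D = upd k' y @^-1` [set y | B (tcons (a, y))].
by apply/funext => t; rewrite /D /= upd_tconsS.
Qed.

End sections.
(** * Unions of coded dyadic boxes *)

Definition dcode (d : nat) := {ffun 'I_d -> int * int}.

Section boxes.
Variable R : realType.
Local Open Scope ereal_scope.
Notation line := (measurableTypeR R).
Notation mu1 := (@lebesgue_measure R).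

Definition box d (s : 'I_d -> set line) : set (Rspace R d) :=
  [set x | forall i, s i (tnth x i)].

Lemma measurable_box d (s : 'I_d -> set line) :
  (forall i, measurable (s i)) -> measurable (box s).
Proof.
move=> ms; rewrite (_ : box s = \bigcap_(i in [set: 'I_d])
    ((fun x : Rspace R d => tnth x i) @^-1` s i)).
  apply: fin_bigcap_measurable => // i _; rewrite -[X in measurable X]setTI.
  exact: measurable_tnth.
by apply/seteqP; split => x H i; [move=> _|]; exact: H.
Qed.

Definition dbox d (r : dcode d) := box (fun i => dset (r i)).
Definition vol d (r : dcode d) : R := (\prod_(i < d) 2 ^ (r i).2)%R.

Lemma measurable_dbox d (r : dcode d) : measurable (dbox r).
Proof. by apply: measurable_box => i; exact: measurable_dset. Qed.

Lemma measurable_bigcup_dbox d S (X : set S) (f : S -> dcode d) :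
  measurable (\bigcup_(s in X) dbox (f s)).
Proof. by apply: measurable_bigcup_factor; exact: measurable_dbox. Qed.

Lemma measure_dbox d (r : dcode d) : lebesgue_nd (dbox r) = (vol r)%:E.
Proof.
rewrite lebesgue_nd_box; last by move=> i; exact: measurable_dset.
by rewrite /vol -prodEFin; apply: eq_bigr => i _; exact: measure_dset.
Qed.

Lemma vol_gt0 d (r : dcode d) : (0 < vol r)%R.
Proof. by apply: prodr_gt0 => i _; exact: pow2_gt0. Qed.

Lemma slice_bigcup_box d (k : 'I_d) x S (X : set S)
    (a : S -> 'I_d -> set line) :
  upd k x @^-1` (\bigcup_(s in X) box (a s)) =
  \bigcup_(s in X `&` [set s | forall i, i != k -> a s i (tnth x i)]) a s k.
Proof.
apply/seteqP; split => t.
  move=> [s Xs st]; exists s; last first.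
    by have := st k; rewrite tnth_mktuple eqxx.
  by split => // i ik; have := st i; rewrite tnth_mktuple (negbTE ik).
move=> [s [Xs sx] st]; exists s => // i; rewrite tnth_mktuple.
by case: eqVneq => [->//|]; exact: sx.
Qed.

(** A one-dimensional inequality between unions of intervals gives the same
    inequality between unions of boxes whose sides change in one direction:
    on each line parallel to it the boxes that are met form a subfamily, which
    is why the hypothesis ranges over all index sets Y. *)
Lemma le_measure_bigcup_box d (k : 'I_d) S (X : set S)
    (a b : S -> 'I_d -> set line) (c : R) : (0 <= c)%R ->
  measurable (\bigcup_(s in X) box (a s)) ->
  measurable (\bigcup_(s in X) box (b s)) ->
  (forall s i, i != k -> b s i = a s i) ->
  (forall Y, mu1 (\bigcup_(s in Y) b s k) <=
             c%:E * mu1 (\bigcup_(s in Y) a s k)) ->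
  lebesgue_nd (\bigcup_(s in X) box (b s)) <=
  c%:E * lebesgue_nd (\bigcup_(s in X) box (a s)).
Proof.
move=> c0 ma mb ab kle; apply: (nd_slice_le (k := k)) => // x.
rewrite !slice_bigcup_box.
set Y := X `&` _; set Z := X `&` _.
have -> : Y = Z; last exact: kle.
apply/seteqP; split => s [Xs h]; split => // i ik; have := h i ik;
  by rewrite ab.
Qed.

Definition anc_lt d (j m : nat) (r : dcode d) : dcode d :=
  [ffun i : 'I_d => if (i < j)%N then anc m (r i) else r i].

Lemma measure_bigcup_anc_lt d S (X : set S) (f : S -> dcode d) (m j : nat) :
  (j <= d)%N ->
  lebesgue_nd (\bigcup_(s in X) dbox (anc_lt j m (f s))) <=
  ((2 ^+ m) ^+ j)%:E * lebesgue_nd (\bigcup_(s in X) dbox (f s)).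
Proof.
elim: j => [_|j IH jd].
  rewrite expr0 mul1e le_eqVlt; apply/orP; left; apply/eqP.
  congr lebesgue_nd; apply: eq_bigcupr => s _; congr dbox.
  by apply/ffunP => i; rewrite ffunE ltn0.
have {IH} := IH (ltnW jd); set L := lebesgue_nd (\bigcup_(s in X) dbox (f s)).
move=> IH; have p0 : (0 < 2 ^+ m :> R)%R by exact: exprn_gt0.
apply: (@le_trans _ _ ((2 ^+ m)%:E *
    lebesgue_nd (\bigcup_(s in X) dbox (anc_lt j m (f s))))).
  apply: (le_measure_bigcup_box (k := Ordinal jd)).
  - exact: ltW.
  - exact: measurable_bigcup_dbox.
  - exact: measurable_bigcup_dbox.
  - move=> s i ij; rewrite !ffunE ltnS leq_eqVlt.
    by rewrite (_ : (i == j :> nat) = false)//; apply/negbTE.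
  move=> Y; under eq_bigcupr do rewrite ffunE /= ltnS leqnn.
  under [X in _ <= _ * _ X]eq_bigcupr do rewrite ffunE /= ltnn.
  exact: (@measure_bigcup_anc R S Y (fun s => f s (Ordinal jd))).
by rewrite exprS EFinM -muleA lee_pmul2l ?lte_fin.
Qed.

(** Boxes tripled in the first j coordinates only, to triple one coordinate at
    a time. *)
Definition tbox_lt d (j : nat) (r : dcode d) :=
  box (fun i : 'I_d => if (i < j)%N then tset (r i) else dset (r i)).

Definition tbox d (r : dcode d) := box (fun i => tset (r i)).

Lemma measurable_bigcup_tbox_lt d j S (X : set S) (f : S -> dcode d) :
  measurable (\bigcup_(s in X) tbox_lt j (f s)).
Proof.
apply: measurable_bigcup_factor => c; apply: measurable_box => i.
by case: ifP => _; [exact: measurable_tset|exact: measurable_dset].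
Qed.

Lemma measurable_bigcup_tbox d S (X : set S) (f : S -> dcode d) :
  measurable (\bigcup_(s in X) tbox (f s)).
Proof.
apply: measurable_bigcup_factor => c; apply: measurable_box => i.
exact: measurable_tset.
Qed.

Lemma measure_bigcup_tbox d S (X : set S) (f : S -> dcode d) :
  lebesgue_nd (\bigcup_(s in X) tbox (f s)) <=
  (3 ^+ d)%:E * lebesgue_nd (\bigcup_(s in X) dbox (f s)).
Proof.
have E : forall j, (j <= d)%N ->
  lebesgue_nd (\bigcup_(s in X) tbox_lt j (f s)) <=
  (3 ^+ j)%:E * lebesgue_nd (\bigcup_(s in X) dbox (f s)).
  elim=> [_|j IH jd]; first by rewrite expr0 mul1e.
  have {IH} := IH (ltnW jd); set L := lebesgue_nd (\bigcup_(s in X) dbox (f s)).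
  move=> IH; apply: (@le_trans _ _ (3%:E *
      lebesgue_nd (\bigcup_(s in X) tbox_lt j (f s)))); last first.
    by rewrite exprS EFinM -muleA lee_pmul2l ?lte_fin.
  apply: (le_measure_bigcup_box (k := Ordinal jd)) => //.
  - exact: measurable_bigcup_tbox_lt.
  - exact: measurable_bigcup_tbox_lt.
  - move=> s i ij; rewrite ltnS leq_eqVlt.
    by rewrite (_ : (i == j :> nat) = false)//; apply/negbTE.
  move=> Y; rewrite /= ltnS leqnn ltnn.
  exact: (@measure_bigcup_tset R S Y (fun s => f s (Ordinal jd))).
apply: le_trans (E d (leqnn d)); apply: le_mu.
- exact: measurable_bigcup_tbox.
- exact: measurable_bigcup_tbox_lt.
by move=> x [s Xs sx]; exists s => // i; rewrite ltn_ord; exact: sx.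
Qed.

Definition code_tail n (r : dcode n.+1) : dcode n :=
  [ffun i => r (lift ord0 i)].

Lemma dbox_tcons n (r : dcode n.+1) a y :
  dbox r (tcons (a, y)) <-> dset (r ord0) a /\ dbox (code_tail r) y.
Proof.
split=> [H|[H0 H] i].
  split; first exact: (H ord0).
  by move=> i; have := H (lift ord0 i); rewrite tnthS ffunE.
case: (unliftP ord0 i) => [j ->|-> //].
by have := H j; rewrite tnthS ffunE.
Qed.

Lemma vol_tail n (r : dcode n.+1) :
  vol r = (2 ^ (r ord0).2 * vol (code_tail r))%R.
Proof.
rewrite /vol big_ord_recl; congr (_ * _)%R.
by apply: eq_bigr => i _; rewrite ffunE.
Qed.

Lemma measurable_ungroup n (G : set (line * Rspace R n)) :
  measurable G ->
  measurable [set x : Rspace R n.+1 | G (thead x, [tuple of behead x])].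
Proof.
move=> mG; rewrite -[X in measurable X]setTI.
apply: (_ : measurable_fun setT (fun x : Rspace R n.+1 =>
  (thead x, [tuple of behead x] : Rspace R n))) => //.
apply/measurable_fun_pair => /=; first exact: measurable_tnth.
exact: measurable_behead.
Qed.

Lemma thead_tcons n (a : line) (y : Rspace R n) : thead (tcons (a, y)) = a.
Proof. exact: theadE. Qed.

Lemma behead_tcons n (a : line) (y : Rspace R n) :
  [tuple of behead (tcons (a, y))] = y.
Proof. exact/val_inj. Qed.

Lemma measurable_dense_fibres n (G : set (Rspace R n.+1)) (p : dcode n)
    (c : R) :
  measurable G ->
  measurable [set a : line | (vol p)%:E <=
     c%:E * lebesgue_nd (dbox p `&` [set y | G (tcons (a, y))])].
Proof.
move=> mG; pose m2 : {sigma_finite_measure set _ -> \bar R} := @lebesgue_nd R n.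
pose H := (setT `*` dbox p) `&` @tcons R n @^-1` G.
have mH : measurable H.
  apply: measurableI; last exact: measurable_tcons_preimage.
  by apply: measurableX => //; exact: measurable_dbox.
have secE a : dbox p `&` [set y | G (tcons (a, y))] = xsection H a.
  apply/seteqP; split => y; rewrite /xsection /= inE /H /=; first by case.
  by case=> -[].
pose f : line -> \bar R := fun a => c%:E * (m2 \o xsection H) a.
have mf : measurable_fun [set: line] f.
  by apply: measurable_funeM; exact: measurable_fun_xsection.
rewrite (_ : [set a | _] = setT `&`
  f @^-1` [set` `[(vol p)%:E, +oo[]).
  by apply: mf => //; exact: emeasurable_itv.
apply/seteqP; split => a /=; rewrite secE /f in_itv /= andbT; first by [].
by case.
Qed.

End boxes.
(** * The strong dyadic density bound *)

Section strong_density.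
Variable R : realType.
Local Open Scope ereal_scope.
Notation line := (measurableTypeR R).
Notation mu1 := (@lebesgue_measure R).

Lemma nd_product n (A : set line) (B : set (Rspace R n)) :
  measurable A -> measurable B ->
  lebesgue_nd [set x : Rspace R n.+1 | A (thead x) /\ B [tuple of behead x]] =
  mu1 A * lebesgue_nd B.
Proof.
move=> mA mB; rewrite /= /pushforward.
pose m2 : {sigma_finite_measure set _ -> \bar R} := @lebesgue_nd R n.
rewrite -[RHS](product_measure1E mu1 m2 mA mB); congr (product_measure1 _ _ _).
apply/seteqP.
by split => -[a y]; rewrite /preimage /mkset thead_tcons behead_tcons.
Qed.

(** Chebyshev: if G fills the fraction 1/c of a box, then the fibres filled to
    at least the fraction 1/(2c) occupy at least the fraction 1/(2c) of the
    first side, because the remaining fibres carry at most half of the mass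
    of G in the box. *)
Lemma dense_fibres n (r : dcode n.+1) (G : set (Rspace R n.+1)) (c : R) :
  (0 < c)%R -> measurable G ->
  (vol R r)%:E <= c%:E * lebesgue_nd (dbox r `&` G) ->
  (2 ^ (r ord0).2)%:E <= (2 * c)%:E * mu1 (dset (r ord0) `&`
    [set a | (vol R (code_tail r))%:E <= (2 * c)%:E *
      lebesgue_nd (dbox (code_tail r) `&` [set y | G (tcons (a, y))])]).
Proof.
move=> c0 mG rG; set p := code_tail r; set D := [set a | _].
have md : measurable (dset (r ord0) : set line) by exact: measurable_dset.
have mD : measurable D by exact: measurable_dense_fibres.
have mp : measurable (dbox p : set (Rspace R n)) by exact: measurable_dbox.
have mr : measurable (dbox r : set (Rspace R n.+1)) by exact: measurable_dbox.
have c20 : (0 < 2 * c)%R by rewrite mulr_gt0.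
(* A1 gathers the full dense fibres, A2 the part of G in the other ones. *)
pose A1 := [set x : Rspace R n.+1 |
  (dset (r ord0) `&` D) (thead x) /\ dbox p [tuple of behead x]].
pose A2 := (dbox r `&` G) `\` A1.
have mA1 : measurable A1.
  apply: (@measurable_ungroup _ _ ((dset (r ord0) `&` D) `*` dbox p)).
  by apply: measurableX => //; exact: measurableI.
have mA2 : measurable A2 by apply: measurableD => //; exact: measurableI.
have A2r : lebesgue_nd A2 <= (2 * c)^-1%:E * lebesgue_nd (dbox r).
  apply: nd_xsection_le => //; first by rewrite invr_ge0 ltW.
  move=> a; have [[ra Da]|nra] := pselect ((dset (r ord0) `&` D) a).
    rewrite (_ : [set y | A2 _] = set0); last first.
      apply/seteqP; split => // y [[/dbox_tcons[_ py] _]]; apply.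
      by rewrite /A1 /mkset thead_tcons behead_tcons.
    by rewrite measure0 mule_ge0// lee_fin invr_ge0 ltW.
  have [ra|nr] := pselect (dset (r ord0) a); last first.
    rewrite (_ : [set y | A2 _] = set0); last first.
      by apply/seteqP; split => // y [[/dbox_tcons[]]].
    by rewrite measure0 mule_ge0// lee_fin invr_ge0 ltW.
  have nD : ~ D a by move=> Da; apply: nra.
  rewrite (_ : [set y | dbox r _] = dbox p); last first.
    by apply/seteqP; split => y /=; rewrite dbox_tcons; [case|].
  rewrite measure_dbox muleC -[leLHS]mule1.
  rewrite -(_ : (2 * c)%:E * (2 * c)^-1%:E = 1); last first.
    by rewrite -EFinM divff// gt_eqF.
  rewrite muleA lee_pmul2r ?lte_fin ?invr_gt0// muleC.
  apply/ltW; move/negP : nD; rewrite -ltNge; apply: le_lt_trans.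
  rewrite lee_pmul2l ?lte_fin//; apply: le_mu.
  - exact: measurable_section.
  - by apply: measurableI => //; exact: measurable_section.
  by move=> y [[/dbox_tcons[_ py] Gy] _].
have h : lebesgue_nd (dbox r `&` G) <=
    mu1 (dset (r ord0) `&` D) * (vol R p)%:E + (2 * c)^-1%:E * (vol R r)%:E.
  rewrite -!measure_dbox -nd_product//; last exact: measurableI.
  apply: le_trans (leeD2l _ A2r); rewrite -/A1.
  apply: le_trans (measureU2 _ _ _) => //; apply: le_mu => //.
  - exact: measurableI.
  - exact: measurableU.
  by move=> x rx; have [|] := pselect (A1 x); [left|right].
have fD : mu1 (dset (r ord0) `&` D) = (fine (mu1 (dset (r ord0) `&` D)))%:E.
  rewrite fineK// ge0_fin_numE ?measure_ge0//.
  apply: (@le_lt_trans _ _ (mu1 (dset (r ord0)))).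
    by apply: le_mu => //; exact: measurableI.
  by rewrite measure_dset ltry.
move: h; rewrite fD; set u := fine _ => h.
have {h} : (vol R r)%:E <= c%:E *
    (u%:E * (vol R p)%:E + (2 * c)^-1%:E * (vol R r)%:E).
  by apply: le_trans rG _; rewrite lee_pmul2l ?lte_fin.
rewrite -!EFinM !lee_fin.
rewrite vol_tail -/p; have := vol_gt0 R p; have := pow2_gt0 R (r ord0).2.
move: (vol R p) (2 ^ _)%R => v s s0 v0 h.
have {h} : (s * v <= c * u * v + s * v / 2)%R.
  apply: le_trans h _; rewrite le_eqVlt; apply/orP; left; apply/eqP.
  by field; rewrite gt_eqF.
move=> h; rewrite -(ler_pM2r v0); lra.
Qed.

(** The level-set bound for the strong maximal function.  In the induction step
    H collects, fibre by fibre, the lower-dimensional boxes dense for that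
    fibre of G; by [dense_fibres] every box of X is dense for H along the first
    coordinate, where [dyadic_density] applies. *)
Lemma strong_density d (c : R) : (0 < c)%R ->
  exists2 K : R, (0 < K)%R &
  forall (X : set (dcode d)) (G : set (Rspace R d)), measurable G ->
    (forall r, X r -> (vol R r)%:E <= c%:E * lebesgue_nd (dbox r `&` G)) ->
    lebesgue_nd (\bigcup_(r in X) dbox r) <= K%:E * lebesgue_nd G.
Proof.
elim: d c => [|n IH] c c0.
  exists c => // X G mG XG.
  have [->|/set0P[r Xr]] := eqVneq X set0.
    by rewrite bigcup_set0 measure0 mule_ge0// lee_fin ltW.
  apply: (@le_trans _ _ (vol R r)%:E).
    rewrite -measure_dbox; apply: le_mu.
    - exact: measurable_bigcup_dbox.
    - exact: measurable_dbox.
    - by move=> x _ [].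
  apply: le_trans (XG r Xr) _; rewrite lee_pmul2l ?lte_fin//.
  apply: le_mu => //; apply: measurableI => //; exact: measurable_dbox.
have c20 : (0 < 2 * c)%R by rewrite mulr_gt0.
have [K K0 HK] := IH _ c20.
exists (2 * c * K)%R; first exact: mulr_gt0.
move=> X G mG XG.
pose D (p : dcode n) := [set a : line | (vol R p)%:E <= (2 * c)%:E *
  lebesgue_nd (dbox p `&` [set y | G (tcons (a, y))])].
have mD p : measurable (D p) by exact: measurable_dense_fibres.
pose H := \bigcup_(p in [set: dcode n]) [set x : Rspace R n.+1 |
  D p (thead x) /\ dbox p [tuple of behead x]].
have mH : measurable H.
  apply: countType_bigcup_measurable => p.
  apply: (@measurable_ungroup _ _ (D p `*` dbox p)).
  by apply: measurableX => //; exact: measurable_dbox.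
have secH a : [set y | H (tcons (a, y))] =
    \bigcup_(p in [set p | D p a]) dbox p.
  apply/seteqP; split => y.
    move=> [p _]; rewrite /mkset thead_tcons behead_tcons => -[Da py].
    by exists p.
  by move=> [p Da py]; exists p => //; rewrite /mkset thead_tcons behead_tcons.
have HG : lebesgue_nd H <= K%:E * lebesgue_nd G.
  apply: nd_xsection_le => //; first exact: ltW.
  by move=> a; rewrite secH; apply: HK => //; exact: measurable_section.
rewrite EFinM -muleA; apply: (@le_trans _ _ ((2 * c)%:E * lebesgue_nd H)).
  apply: nd_ysection_le => //; [exact: ltW|exact: measurable_bigcup_dbox|].
  move=> y; rewrite (_ : [set a | _] = \bigcup_(r in
    X `&` [set r | dbox (code_tail r) y]) dset (r ord0)); last first.
    apply/seteqP; split => a.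
      by move=> [r Xr /dbox_tcons[ra ry]]; exists r.
    by move=> [r [Xr ry] ra]; exists r => //; exact/dbox_tcons.
  have mHy : measurable [set a | H (tcons (a, y))].
    rewrite (_ : [set a | _] = ysection (@tcons R n @^-1` H) y).
      by apply: measurable_ysection; exact: measurable_tcons_preimage.
    by apply/seteqP; split => a; rewrite /ysection /= inE.
  apply: (@dyadic_density R _ _ (fun r : dcode n.+1 => r ord0)) => //.
  move=> r [Xr ry]; rewrite measure_dset.
  apply: le_trans (dense_fibres c0 mG (XG r Xr)) _.
  rewrite lee_pmul2l ?lte_fin//; apply: le_mu.
  - by apply: measurableI; [exact: measurable_dset|exact: mD].
  - by apply: measurableI => //; exact: measurable_dset.
  move=> a [ra Da]; split => //; exists (code_tail r) => //.
  by rewrite /mkset thead_tcons behead_tcons.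
by rewrite lee_pmul2l ?lte_fin.
Qed.

End strong_density.
(** * Sums of measures with bounded overlap *)

Section overlap.
Context dsp (T : measurableType dsp) (R : realType).
Local Open Scope ereal_scope.

(** When the sets within each of n classes are disjoint, each class contributes
    at most the measure of B. *)
Lemma sum_measure_le_classes (mu : {measure set T -> \bar R}) (C : choiceType)
    (X : set C) (A : C -> set T) (B : set T) (n : nat) (cl : C -> 'I_n) :
  finite_set X -> measurable B -> (forall i, X i -> measurable (A i)) ->
  (forall i, X i -> A i `<=` B) ->
  (forall i j x, X i -> X j -> cl i = cl j -> A i x -> A j x -> i = j) ->
  \sum_(i \in X) mu (A i) <= n%:R%:E * mu B.
Proof.
move=> fX mB mA AB tA.
have le_class (c : 'I_n) :
    \sum_(i \in X `&` [set i | cl i = c]) mu (A i) <= mu B.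
  rewrite -measure_fin_bigcup//.
  - apply: le_mu => //; last by move=> x [i [Xi _]]; exact: AB.
    apply: fin_bigcup_measurable => [|i [Xi _]]; last exact: mA.
    exact: finite_setIl.
  - exact: finite_setIl.
  - move=> i j [Xi ci] [Xj cj] [x [Aix Ajx]].
    by apply: (tA i j x); rewrite ?ci ?cj.
  - by move=> i [Xi _]; exact: mA.
rewrite fsbig_finite//= (partition_big cl xpredT)//=.
apply: (@le_trans _ _ (\sum_(c < n) mu B)); last first.
  by rewrite sumr_const card_ord /= mule_natl.
apply: lee_sum => c _; apply: le_trans (le_class c).
rewrite fsbig_mkcondr fsbig_finite//= [leLHS]big_mkcond/=.
rewrite le_eqVlt; apply/orP; left; apply/eqP; apply: eq_bigr => i _.
by case: eqP => ci; [rewrite mem_set|rewrite memNset].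
Qed.

End overlap.

(** * Boxes with ancestors in the first coordinates *)

Section ancestors_of_boxes.
Variable R : realType.
Local Open Scope ereal_scope.

Lemma anc_lt0 d m (r : dcode d) : anc_lt 0 m r = r.
Proof. by apply/ffunP => i; rewrite ffunE ltn0. Qed.

Lemma anc_lt_id d j (r : dcode d) : anc_lt j 0 r = r.
Proof. by apply/ffunP => i; rewrite ffunE anc0; case: ifP. Qed.

Lemma anc_lt_eq d (j : 'I_d) m (r : dcode d) : anc_lt j m r j = r j.
Proof. by rewrite ffunE ltnn. Qed.

Lemma anc_lt_succ d (j : 'I_d) m (r : dcode d) i :
  anc_lt j.+1 m r i = if i == j then anc m (r j) else anc_lt j m r i.
Proof. by rewrite !ffunE ltnS leq_eqVlt val_eqE; case: eqVneq => [->|]. Qed.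

Lemma vol_anc_lt_succ d (j : 'I_d) m (r : dcode d) :
  vol R (anc_lt j.+1 m r) = (2 ^+ m * vol R (anc_lt j m r))%R.
Proof.
have volD s : vol R s = (2 ^ (s j).2 * \prod_(i < d | i != j) 2 ^ (s i).2)%R.
  by rewrite /vol (bigD1 j).
rewrite !volD anc_lt_eq anc_lt_succ eqxx /anc /= expfzDr ?pnatr_eq0// -exprnP.
rewrite mulrA [(2 ^+ m * _)%R]mulrC; congr (_ * _)%R.
by apply: eq_bigr => i ij; rewrite anc_lt_succ (negbTE ij).
Qed.

Lemma vol_anc_lt d j m (r : dcode d) : (j <= d)%N ->
  vol R (anc_lt j m r) = ((2 ^+ m) ^+ j * vol R r)%R.
Proof.
elim: j => [_|j IH jd]; first by rewrite anc_lt0 expr0 mul1r.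
rewrite (vol_anc_lt_succ (Ordinal jd)) /= IH ?(ltnW jd)//.
by rewrite exprS mulrA.
Qed.

End ancestors_of_boxes.

(** * Enlarged shadows, stopping levels and the estimate in one direction *)

Section main_estimate.
Variables (R : realType) (d : nat).
Local Open Scope ereal_scope.
Notation mu := (@lebesgue_nd R d).
Implicit Types (G : set (Rspace R d)) (U X : set (dcode d)) (r : dcode d).

Definition dshadow U : set (Rspace R d) := \bigcup_(r in U) dbox r.

Lemma measurable_dshadow U : measurable (dshadow U).
Proof. exact: (@measurable_bigcup_dbox R d _ U id). Qed.

Definition half_dense G : set (dcode d) :=
  [set r | (vol R r)%:E <= 2%:E * mu (dbox r `&` G)].

(** Isolates the part of [strong_density] used from here on. *)
Definition half_density_constant (K : R) :=
  (0 < K)%R /\ forall X G, measurable G -> X `<=` half_dense G ->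
    mu (dshadow X) <= K%:E * mu G.

Lemma half_dense_sub G r : measurable G -> dbox r `<=` G -> half_dense G r.
Proof.
move=> mG rG; rewrite /half_dense /mkset (setIidl rG) measure_dbox.
rewrite -EFinM lee_fin.
by rewrite ler_peMl ?ler1n// ltW// vol_gt0.
Qed.

Fixpoint enlarged U j : set (Rspace R d) :=
  if j is i.+1 then dshadow (half_dense (enlarged U i)) else dshadow U.

Lemma measurable_enlarged U j : measurable (enlarged U j).
Proof. by case: j => [|j]; exact: measurable_dshadow. Qed.

Lemma enlarged_box U j x : enlarged U j x ->
  exists2 r, dbox r x & dbox r `<=` enlarged U j.
Proof. by case: j => [|j] [r Ur rx]; exists r => // y ry; exists r. Qed.

Lemma sub_enlarged U j : dshadow U `<=` enlarged U j.
Proof.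
elim: j => [//|j IH]; apply: (subset_trans IH) => x /enlarged_box[r rx rU].
by exists r => //; apply: half_dense_sub => //; exact: measurable_enlarged.
Qed.

Lemma measure_enlarged (K : R) U j : half_density_constant K ->
  mu (enlarged U j) <= (K ^+ j)%:E * mu (dshadow U).
Proof.
move=> [K0 HK]; elim: j => [|j IH]; first by rewrite expr0 mul1e.
apply: le_trans (HK _ _ (measurable_enlarged U j) (@subset_refl _ _)) _.
by rewrite exprS EFinM -muleA lee_pmul2l ?lte_fin.
Qed.

(** In mj, the first component is the last level before the first bad one, and
    the second is the first coordinate at which the next level fails. *)
Lemma stopping_level (K : R) U : (0 < d)%N -> half_density_constant K ->
  mu (dshadow U) < +oo ->
  forall r, U r -> exists mj : nat * 'I_d,
    [/\ half_dense (enlarged U d.-1) (anc_lt d mj.1 r),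
        dbox (anc_lt mj.2 mj.1.+1 r) `<=` enlarged U mj.2 &
        ~ half_dense (enlarged U mj.2) (anc_lt mj.2.+1 mj.1.+1 r)].
Proof.
move=> d_gt0 KP Ufin r Ur.
pose dense m j := half_dense (enlarged U j) (anc_lt j.+1 m r).
pose good m := `[< forall j : 'I_d, dense m j >].
have dE : d = d.-1.+1 by rewrite prednK.
have good_last m : good m -> half_dense (enlarged U d.-1) (anc_lt d m r).
  move=> /asboolP gm; have lt : (d.-1 < d)%N by rewrite -dE.
  by have := gm (Ordinal lt); rewrite /dense /= -dE.
have good0 : good 0%N.
  apply/asboolP => j; rewrite /dense anc_lt_id.
  apply: half_dense_sub; first exact: measurable_enlarged.
  by move=> x rx; apply: sub_enlarged; exists r.
have Vfin : mu (enlarged U d) = (fine (mu (enlarged U d)))%:E.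
  rewrite fineK// ge0_fin_numE ?measure_ge0//.
  apply: le_lt_trans (measure_enlarged U d KP) _.
  by rewrite lte_mul_pinfty// lee_fin exprn_ge0// ltW//; have [] := KP.
(* A good level m gives 2^m |R| <= |R^(d,m)| <= |V_d|. *)
pose B := (fine (mu (enlarged U d)) / vol R r)%R.
have good_bound m : good m -> (2 ^+ m <= B)%R.
  move=> /good_last gm; rewrite ler_pdivlMr ?vol_gt0// -lee_fin -Vfin.
  apply: (@le_trans _ _ (vol R (anc_lt d m r))%:E).
    rewrite lee_fin vol_anc_lt// ler_pM2r ?vol_gt0// dE exprS.
    by rewrite ler_peMr ?exprn_ge0// !exprn_ege1// ler1n.
  rewrite -measure_dbox; apply: le_mu.
  - exact: measurable_dbox.
  - exact: measurable_enlarged.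
  by rewrite (congr1 (enlarged U) dE) => x rx; exists (anc_lt d m r).
have exbad : exists m, ~~ good m.+1.
  apply/not_existsP => H.
  have /good_bound : good (Num.trunc B).+1.
    by apply: contrapT => /negP; exact: H.
  apply/negP; rewrite -ltNge.
  have := truncnS_gt B; move=> /lt_le_trans; apply.
  by rewrite -natrX ler_nat; exact/ltnW/ltn_expl.
case: (ex_minnP exbad) => m bad minm.
have goodm : good m.
  case: m bad minm => [//|m] bad minm; apply: contrapT => /negP /minm.
  by rewrite ltnn.
have exj : exists j, (j < d)%N && ~~ `[< dense m.+1 j >].
  apply: contrapT => H; move/asboolP : bad; apply => j.
  apply: contrapT => nd; apply: H; exists j.
  by rewrite ltn_ord /=; apply/asboolP.
case: (ex_minnP exj) => j /andP[jd /asboolP nd] minj.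
exists (m, Ordinal jd); split => //=; first exact: good_last.
case: j {nd exj} jd minj => [|j] jd minj.
  by rewrite anc_lt0 => x rx; exists r.
move=> x rx; exists (anc_lt j.+1 m.+1 r) => //.
apply: contrapT => nd.
suff : (j.+1 <= j)%N by rewrite ltnn.
by apply: minj; rewrite (ltnW jd) /=; apply/asboolP.
Qed.

Variables (K : R) (U : set (dcode d)) (lev : dcode d -> nat)
  (dir : dcode d -> 'I_d).
Hypothesis KP : half_density_constant K.
Hypothesis lev_dir : forall r, U r ->
  dbox (anc_lt (dir r) (lev r).+1 r) `<=` enlarged U (dir r) /\
  ~ half_dense (enlarged U (dir r)) (anc_lt (dir r).+1 (lev r).+1 r).

Section fixed_direction.
Variables (U' : set (dcode d)) (j : 'I_d) (v : nat).
Hypothesis U'U : U' `<=` U.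

Let Y := [set r | [/\ U' r, lev r = v & dir r = j]].
Let N (I : int * int) := Y `&` [set r | r j = I].
Let H I : set (Rspace R d) := \bigcup_(r in N I) dbox (anc_lt j v.+1 r).
Let W I : set (Rspace R d) :=
  \bigcup_(r in Y `&` [set r | exists m, r j = anc m (anc v.+1 I)])
    dbox (anc_lt j v.+1 r).

Let measurable_H I : measurable (H I).
Proof. exact: measurable_bigcup_dbox. Qed.

Let measurable_W I : measurable (W I).
Proof. exact: measurable_bigcup_dbox. Qed.

Let W_sub I : W I `<=` enlarged U j.
Proof.
move=> x [r [[U'r lr dr] _] rx].
by have [h _] := lev_dir (U'U U'r); move: h; rewrite lr dr; exact.
Qed.

(** On a line in the direction j, either W_I misses the box P, or it contains
    the whole ancestor of order v+1 of I, which is the side of P^+. *)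
Let slab_le I r : N I r ->
  mu (dbox (anc_lt j v.+1 r) `&` W I) <=
  (2 ^+ v.+1)^-1%:E * mu (dbox (anc_lt j.+1 v.+1 r) `&` W I).
Proof.
move=> [Yr rI].
have mA : measurable (dbox (anc_lt j v.+1 r) `&` W I).
  by apply: measurableI => //; exact: measurable_dbox.
have mB : measurable (dbox (anc_lt j.+1 v.+1 r) `&` W I).
  by apply: measurableI => //; exact: measurable_dbox.
apply: (nd_slice_le (k := j)) => // x.
set A := upd j x @^-1` _; set B := upd j x @^-1` _.
have [->|/set0P[t [At Wt]]] := eqVneq A set0.
  by rewrite measure0 mule_ge0// lee_fin invr_ge0 exprn_ge0.
have AI : A `<=` dset I.
  by move=> s [/(_ j)]; rewrite anc_lt_eq tnth_mktuple eqxx rI.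
have IB : dset (anc v.+1 I) `<=` B.
  move=> s Is; split.
    move=> i; have := At i; rewrite anc_lt_succ !tnth_mktuple.
    by case: eqVneq => // _ _; rewrite rI.
  case: Wt => q [Yq [m qE]] qt; exists q; first by split => //; exists m.
  move=> i; have := qt i; rewrite !tnth_mktuple; case: eqVneq => // -> _.
  by rewrite anc_lt_eq qE; exact: dset_anc.
apply: (@le_trans _ _ (lebesgue_measure (dset I : set (measurableTypeR R)))).
  by apply: le_mu => //; [exact: measurable_slice|exact: measurable_dset].
rewrite lee_pdivlMl ?exprn_gt0//.
apply: (@le_trans _ _
    (lebesgue_measure (dset (anc v.+1 I) : set (measurableTypeR R)))).
  by rewrite !measure_dset -EFinM lee_fin /anc /= expfzDr ?pnatr_eq0// mulrC.
by apply: le_mu => //; [exact: measurable_dset|exact: measurable_slice].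
Qed.

(** Failure at the coordinate j: V_j, hence W_I, fills less than half of P^+,
    and so less than half of P. *)
Let half_outside I r : N I r ->
  (vol R (anc_lt j v.+1 r))%:E <=
  2%:E * mu (dbox (anc_lt j v.+1 r) `&` (H I `\` W I)).
Proof.
move=> Nr; have [[U'r lr dr] rI] := Nr.
set p := anc_lt j v.+1 r; set q := anc_lt j.+1 v.+1 r.
have mp : measurable (dbox p : set (Rspace R d)) by exact: measurable_dbox.
have mq : measurable (dbox q : set (Rspace R d)) by exact: measurable_dbox.
have [_] := lev_dir (U'U U'r); rewrite lr dr -/q => /negP; rewrite -ltNge => hq.
have {}hq : 2%:E * mu (dbox q `&` W I) < (vol R q)%:E.
  apply: le_lt_trans hq; rewrite lee_pmul2l ?lte_fin//; apply: le_mu.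
  - exact: measurableI.
  - by apply: measurableI => //; exact: measurable_enlarged.
  by apply: setIS; exact: W_sub.
have pH : dbox p `&` (H I `\` W I) = dbox p `\` W I.
  apply/seteqP; split => x; first by move=> [px [_ nW]].
  by move=> [px nW]; split => //; split => //; exists r.
have fin_part (B C : set (Rspace R d)) (u : R) : measurable B -> measurable C ->
    C `<=` B -> mu B = u%:E -> exists c : R, mu C = c%:E.
  move=> mB mC CB Bu; exists (fine (mu C)); rewrite fineK//.
  rewrite ge0_fin_numE ?measure_ge0//.
  by apply: le_lt_trans (le_mu mu mC mB CB) _; rewrite [ltLHS]Bu ltry.
have [a aE] : exists a : R, mu (dbox p `&` W I) = a%:E.
  by apply: (fin_part (dbox p)); [|exact: measurableI| |exact: measure_dbox].
have [b bE] : exists b : R, mu (dbox p `\` W I) = b%:E.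
  by apply: (fin_part (dbox p)); [|exact: measurableD| |exact: measure_dbox].
have [c cE] : exists c : R, mu (dbox q `&` W I) = c%:E.
  by apply: (fin_part (dbox q)); [|exact: measurableI| |exact: measure_dbox].
have vE : vol R p = (a + b)%R.
  apply: EFin_inj; rewrite -measure_dbox EFinD -aE -bE addeC.
  exact: (measureDI mu mp (measurable_W I)).
rewrite pH bE -EFinM lee_fin.
have := slab_le Nr; rewrite -/p -/q aE cE -EFinM lee_fin mulrC => h3.
move: hq; rewrite cE -EFinM lte_fin vol_anc_lt_succ -/p => h4.
have t0 : (0 < 2 ^+ v.+1 :> R)%R by exact: exprn_gt0.
move: h3; rewrite ler_pdivlMr// => h3.
have : (2 * a * 2 ^+ v.+1 < vol R p * 2 ^+ v.+1)%R by lra.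
by rewrite ltr_pM2r// => h5; lra.
Qed.

Let H_le I : mu (H I) <= K%:E * mu (H I `\` W I).
Proof.
rewrite /H -(bigcup_image (N I) (fun r => anc_lt j v.+1 r) (fun r => dbox r)).
have [_] := KP; apply.
  by apply: measurableD; [exact: measurable_bigcup_dbox|].
by move=> _ [r Nr <-]; rewrite bigcup_image; exact: half_outside.
Qed.

(** The classes are the scales modulo v+1.  If two intervals of the same class
    belong to meeting sets, the larger one contains the ancestor of order v+1
    of the smaller one, unless they coincide; its boxes have then been removed
    with W. *)
Lemma fixed_direction_estimate (C : choiceType) (X : set C)
    (f : C -> int * int) :
  finite_set X -> {in X &, injective f} ->
  \sum_(I \in X) mu (\bigcup_(r in N (f I)) dbox r) <=
  (K * v.+1%:R * (2 ^+ v.+1) ^+ j)%:E * mu (dshadow U').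
Proof.
move=> fX injf.
pose Z := \bigcup_(r in Y) (dbox (anc_lt j v.+1 r) : set (Rspace R d)).
have mZ : measurable Z by exact: measurable_bigcup_dbox.
have mHW I : measurable (H I `\` W I) by exact: measurableD.
apply: (@le_trans _ _ (\sum_(I \in X) (K%:E * mu (H (f I) `\` W (f I))))).
  rewrite !fsbig_finite//=; apply: lee_sum => I _.
  apply: le_trans (H_le (f I)); apply: le_mu => //.
    exact: measurable_bigcup_dbox.
  move=> x [r Nr rx]; exists r => // i; have := rx i; rewrite ffunE.
  by case: ifP => // _; exact: dset_anc.
rewrite -ge0_mule_fsumr; last by move=> I; exact: measure_ge0.
have [K0 _] := KP; rewrite EFinM EFinM -muleA -muleA lee_pmul2l ?lte_fin//.
apply: (@le_trans _ _ (v.+1%:R%:E * mu Z)); last first.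
  rewrite lee_pmul2l ?lte_fin ?ltr0Sn//.
  have jd : (j <= d)%N by exact: ltnW.
  apply: le_trans (@measure_bigcup_anc_lt R d _ Y id v.+1 j jd) _.
  rewrite lee_pmul2l ?lte_fin ?exprn_gt0//; apply: le_mu.
  - exact: measurable_bigcup_dbox.
  - exact: measurable_dshadow.
  by move=> x [r [U'r _ _] rx]; exists r.
pose cl I : 'I_v.+1 := inord (absz ((f I).2 %% v.+1)%Z).
apply: (@sum_measure_le_classes _ _ _ mu C X
  (fun I => H (f I) `\` W (f I)) Z v.+1 cl) => //.
  by move=> I XI x [[r [Yr _] rx] _]; exists r.
suff main I I' x : X I -> X I' -> cl I = cl I' -> ((f I).2 <= (f I').2)%R ->
    (H (f I) `\` W (f I)) x -> (H (f I') `\` W (f I')) x -> f I = f I'.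
  move=> I I' x XI XI' ee hI hI'; apply: injf; rewrite ?inE//.
  by have [le|/ltW le] := leP (f I).2 (f I').2;
    [exact: (main I I' x)|apply/esym/(main I' I x)].
move=> XI XI' ee le [[r [Yr rI] rx] nW] [[r' [Yr' rI'] rx'] _].
have Ix : dset (f I) (tnth x j) by have := rx j; rewrite anc_lt_eq rI.
have Ix' : dset (f I') (tnth x j) by have := rx' j; rewrite anc_lt_eq rI'.
have E := dset_nested Ix Ix' le.
have [E0|ne] := eqVneq (f I').2 (f I).2.
  by rewrite E E0 subrr anc0.
case: nW; exists r' => //; split => //.
move: E; set n := absz _ => E.
suff vn : (v.+1 <= n)%N.
  exists (n - v.+1)%N; rewrite (anc_anc _ _ Ix) subnKC//.
  by rewrite /mkset rI'.
have mod_lt z : (absz (z %% v.+1)%Z < v.+1)%N.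
  have := @ltz_pmod z v.+1 isT; have := @modz_ge0 z v.+1 isT; lia.
have modE : ((f I).2 %% v.+1)%Z = ((f I').2 %% v.+1)%Z.
  move: ee => /(congr1 val); rewrite /= !inordK// => e.
  have := @modz_ge0 (f I').2 v.+1 isT; have := @modz_ge0 (f I).2 v.+1 isT; lia.
have : (v.+1 %| ((f I').2 - (f I).2)%R)%Z by rewrite -eqz_mod_dvd modE.
rewrite dvdzE => /dvdn_leq; apply.
by rewrite absz_gt0 subr_eq0.
Qed.

End fixed_direction.
End main_estimate.
(** * From coded boxes back to dyadic rectangles *)

Section codes_of_rectangles.
Variable R : realType.

Lemma dyadic_decode : exists f : interval R -> int * int,
  forall I, dyadic I -> I = ditv R (f I).
Proof.
have H (I : interval R) : exists p, dyadic I -> I = ditv R p.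
  have [[n [k IE]]|nI] := pselect (dyadic I); first by exists (n, k).
  by exists (0, 0).
by have [f fP] := choice H; exists f.
Qed.

(** The dilate is concentric with an interval inside its ancestor of order v
    and has the same length as that ancestor. *)
Lemma dilate_itv_sub_tset (p : int * int) (v : nat) :
  [set` dilate_itv (2 ^+ v) (ditv R p)] `<=`
  (tset (anc v p) : set (measurableTypeR R)).
Proof.
move=> x; rewrite /= /tset /anc /= !in_itv /= expfzDr ?pnatr_eq0// -exprnP.
have h1 : (p.1 %/ 2 ^+ v)%Z * 2 ^+ v <= p.1 by rewrite lez_floor// expf_neq0.
have h2 : p.1 + 1 <= ((p.1 %/ 2 ^+ v)%Z + 1) * 2 ^+ v.
  by have := @ltz_ceil p.1 (2 ^+ v); rewrite exprn_gt0// => /(_ isT); lia.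
move: h1 h2; set q := (p.1 %/ _)%Z; set s := 2 ^ p.2.
have s0 : 0 < s by exact: pow2_gt0.
have EL : (2 ^+ v : R) = (2 ^+ v : int)%:~R by rewrite rmorphXn.
rewrite -(ler_int R) -(ler_int R (p.1 + 1)) !intrM -EL => h1 h2.
have L1 : 1 <= 2 ^+ v :> R by rewrite exprn_ege1// ler1n.
move: h1 h2 L1 {EL}; set L := 2 ^+ v.
rewrite !(intrD, intrB) => h1 h2 L1 /andP[h3 h4].
have g1 : q%:~R * L * s <= p.1%:~R * s by rewrite ler_pM2r.
have g2 : (p.1%:~R + 1) * s <= (q%:~R + 1%:~R) * L * s by rewrite ler_pM2r.
have Ls : 1 * s <= L * s by rewrite ler_pM2r.
apply/andP; split; nra.
Qed.

End codes_of_rectangles.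

Section summation.
Variable R : realType.

(** The loss is 2^v for the overlap, as v+1 <= 2^v, and 2^(v+1) for each of the
    at most d-1 coordinates in which ancestors were taken. *)
Lemma weight_le (d j v : nat) (eps : R) : (j < d)%N ->
  2 `^ (- ((d%:R + eps) * v%:R)) * (v.+1%:R * (2 ^+ v.+1) ^+ j) <=
  2 ^+ d * (2 `^ (- eps)) ^+ v.
Proof.
move=> jd.
have -> : 2 `^ (- ((d%:R + eps) * v%:R)) =
    (2 ^+ (d * v))^-1 * (2 `^ (- eps)) ^+ v.
  rewrite mulrDl opprD powRD; last by apply/implyP => _; rewrite pnatr_eq0.
  congr (_ * _); first by rewrite powRN -natrM powR_mulrn.
  by rewrite -mulNr powRrM powR_mulrn ?powR_ge0.
rewrite mulrAC ler_wpM2r ?exprn_ge0 ?powR_ge0//.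
rewrite mulrC ler_pdivrMr ?exprn_gt0//.
rewrite -exprM -natrX -!natrX -!natrM ler_nat.
apply: (@leq_trans (2 ^ v * 2 ^ (v.+1 * d.-1))).
  apply: leq_mul; first exact: ltn_expl.
  by rewrite leq_exp2l// leq_mul2l /=; case: d jd.
by rewrite -!expnD leq_exp2l//; case: d jd => // d _ /=; nia.
Qed.

Local Open Scope ereal_scope.

Lemma nneseries_le_geometric (u : nat -> \bar R) (c w : R) (s : \bar R) :
  (0 <= c)%R -> (0 < w < 1)%R -> 0 <= s -> (forall v, 0 <= u v) ->
  (forall v, u v <= (c * w ^+ v)%:E * s) ->
  \sum_(0 <= v <oo) u v <= (c / (1 - w))%:E * s.
Proof.
move=> c0 /andP[w0 w1] s0 u0 us.
apply: lime_le; first by apply: is_cvg_nneseries.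
apply: nearW => n.
apply: (@le_trans _ _ (\sum_(0 <= v < n) ((c * w ^+ v)%:E * s))).
  by apply: lee_sum => v _.
rewrite -ge0_sume_distrl; last first.
  by move=> v _; rewrite lee_fin mulr_ge0// exprn_ge0// ltW.
apply: lee_wpmul2r => //; rewrite sumEFin lee_fin.
have := @geometric_le_lim R n c w c0 w0.
by rewrite gtr0_norm// => /(_ w1).
Qed.

End summation.

Theorem lemma35 (R : realType) (d : nat) (hd : (2 <= d)%N)
    (eps : R) (heps : 0 < eps) :
  exists Cd Cde : R,
  forall U : set (d.-tuple (interval R)),
    U `<=` dyadic_rect ->
    (lebesgue_nd (shadow U) < +oo)%E ->
  exists (V : set (Rspace R d)) (emb : d.-tuple (interval R) -> R)
      (iota : d.-tuple (interval R) -> 'I_d),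
    [/\ measurable V,
        shadow U `<=` V,
        (lebesgue_nd V <= Cd%:E * lebesgue_nd (shadow U))%E,
        forall Q, U Q -> 1 <= emb Q /\ rect_set (dilate (emb Q) Q) `<=` V
      & forall U' : set (d.-tuple (interval R)), U' `<=` U ->
        (\sum_(j < d) \sum_(0 <= v <oo) \esum_(I in dyadic)
           ((2 `^ (- ((d%:R + eps) * v%:R)))%:E
              * lebesgue_nd (Fset emb iota I j v U'))
         <= Cde%:E * lebesgue_nd (shadow U'))%E].
Proof.
have d0 : (0 < d)%N by exact: ltnW.
have [K K0 HK] := @strong_density R d 2 (ltr0Sn _ 1).
have KP : half_density_constant d K by split.
pose w : R := 2 `^ (- eps).
have w01 : 0 < w < 1.
  rewrite powR_gt0//=; rewrite /w powRN invf_lt1 ?powR_gt0//.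
  have : 1 `^ eps < 2 `^ eps by apply: gt0_ltr_powR; rewrite ?nnegrE ?ltr1n.
  by rewrite powR1.
exists (3 ^+ d * K ^+ d), (d%:R * (K * 2 ^+ d / (1 - w))) => U Udy Ufin.
have [f fP] := dyadic_decode R.
have f_inj X : X `<=` dyadic -> {in X &, injective f}.
  move=> XD I I' /[!inE] /XD ID /XD ID' e.
  by rewrite (fP _ ID) (fP _ ID') e.
pose cd (Q : d.-tuple (interval R)) : dcode d := [ffun i => f (tnth Q i)].
have rectE Q : dyadic_rect Q -> rect_set Q = dbox (cd Q).
  move=> QD.
  have side i : [set` tnth Q i] = dset (cd Q i) :> set (measurableTypeR R).
    by rewrite ffunE [in LHS](fP _ (QD i)).
  by apply/seteqP; split => x Qx i; have := Qx i; rewrite side.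
have shadowE (X : set (d.-tuple (interval R))) :
    X `<=` dyadic_rect -> shadow X = dshadow (cd @` X).
  move=> XD; rewrite /dshadow bigcup_image; apply: eq_bigcupr => Q XQ.
  exact/rectE/XD.
pose Uc := cd @` U.
have Ucfin : (lebesgue_nd (dshadow Uc : set (Rspace R d)) < +oo)%E.
  by rewrite -shadowE.
have /choice[mj mjP] : forall r, exists mj : nat * 'I_d, Uc r ->
    [/\ half_dense (@enlarged R d Uc d.-1) (anc_lt d mj.1 r),
        dbox (anc_lt mj.2 mj.1.+1 r) `<=` @enlarged R d Uc mj.2 &
        ~ half_dense (@enlarged R d Uc mj.2) (anc_lt mj.2.+1 mj.1.+1 r)].
  move=> r; have [Ur|nU] := pselect (Uc r); last by exists (0%N, Ordinal d0).
  by have [mj] := stopping_level d0 KP Ucfin Ur; exists mj.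
pose S := half_dense (enlarged Uc d.-1 : set (Rspace R d)).
have dE : d = d.-1.+1 by rewrite prednK.
have SE : dshadow S = enlarged Uc d :> set (Rspace R d).
  by rewrite (congr1 (enlarged Uc) dE).
pose emb Q : R := 2 ^+ (mj (cd Q)).1; pose iota Q := (mj (cd Q)).2.
exists (\bigcup_(r in S) tbox r), emb, iota; split.
- exact: (@measurable_bigcup_tbox R d _ S id).
- rewrite shadowE// => x Ux.
  have : (enlarged Uc d : set (Rspace R d)) x by exact: sub_enlarged.
  rewrite -SE => -[r Sr rx]; exists r => // i; exact/dset_sub_tset/rx.
- apply: le_trans (@measure_bigcup_tbox R d _ S id) _.
  rewrite EFinM -muleA lee_pmul2l ?lte_fin ?exprn_gt0//.
  rewrite shadowE// -[X in lebesgue_nd X]/(dshadow S) SE.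
  exact: measure_enlarged.
- move=> Q UQ; split; first by rewrite exprn_ege1// ler1n.
  have [|Sr _ _] := mjP (cd Q); first by exists Q.
  move=> x Qx; exists (anc_lt d (mj (cd Q)).1 (cd Q)) => // i.
  have := Qx i; rewrite tnth_map (fP _ (Udy Q UQ i)) ffunE ltn_ord ffunE.
  exact: dilate_itv_sub_tset.
move=> U' U'U.
have U'D : U' `<=` dyadic_rect by exact: subset_trans Udy.
rewrite (shadowE _ U'D) EFinM -muleA.
set s := lebesgue_nd (dshadow (cd @` U')).
have s0 : (0 <= s)%E by exact: measure_ge0.
have -> : (d%:R%:E * ((K * 2 ^+ d / (1 - w))%:E * s) =
    \sum_(j < d) ((K * 2 ^+ d / (1 - w))%:E * s))%E.
  by rewrite sumr_const card_ord mule_natl.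
apply: lee_sum => j _.
apply: nneseries_le_geometric => //.
  by rewrite mulr_ge0// ltW.
  move=> v; apply: esum_ge0 => I _; apply: mule_ge0.
    by rewrite lee_fin powR_ge0.
  exact: measure_ge0.
move=> v; apply: ge_ereal_sup => _ [X [fX XD] <-].
rewrite -ge0_mule_fsumr//.
have Fle I : dyadic I ->
  (lebesgue_nd (Fset emb iota I j v U') <=
   @lebesgue_nd R d (\bigcup_(r in [set r | [/\ (cd @` U') r, (mj r).1 = v &
     (mj r).2 = j]] `&` [set r | r j = f I]) dbox r))%E.
  move=> ID; rewrite /Fset shadowE; last by move=> Q [/U'D].
  apply: le_mu; [exact: measurable_dshadow|exact: measurable_dshadow|].
  move=> x [_ [Q [U'Q vQ QI jQ] <-] rx]; exists (cd Q) => //; split.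
    split => //.
    have gt2 : 1 < 2 :> R by rewrite ltr1n.
    move: vQ; rewrite /emb (ler_eXn2l gt2) (ltr_eXn2l gt2).
    by rewrite ltnS -eqn_leq => /eqP.
  by rewrite /mkset ffunE QI.
have sub : cd @` U' `<=` Uc by apply: image_subset.
have est := @fixed_direction_estimate R d K Uc (fun r => (mj r).1)
  (fun r => (mj r).2) KP _ _ j v sub _ X f fX (f_inj X XD).
apply: (@le_trans _ _ ((2 `^ (- ((d%:R + eps) * v%:R)))%:E *
   ((K * v.+1%:R * (2 ^+ v.+1) ^+ j)%:E * s))%E).
  apply: lee_wpmul2l; first by rewrite lee_fin powR_ge0.
  apply: le_trans (est _).
    rewrite !fsbig_finite//= !big_seq; apply: lee_sum => I.
    by rewrite in_fset_set// inE => /XD/Fle.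
  by move=> r Ur; have [_ h1 h2] := mjP r Ur.
rewrite muleA -EFinM; apply: lee_wpmul2r => //; rewrite lee_fin.
rewrite -!mulrA [leLHS]mulrCA ler_pM2l//; exact: weight_le.
Qed.
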